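(* Let $(a_n)_{n\geqslant 1}$ and $(p_n)_{n\geqslant 1}$ be sequences of positive real numbers. For $n\geqslant 1$ let $t_n=(a_1+(a_2+\cdots+(a_{n-1}+a_n^{p_n})^{p_{n-1}}\cdots)^{p_2})^{p_1}$, and define functions $f_k$ by $f_0(y)=y$ and $f_k(y)=(f_{k-1}(y))^{1/p_k}-a_k$ for $k\geqslant 1$. Then for every $n\geqslant 1$, $$t_{n+1}-t_n \leqslant a_{n+1}^{p_{n+1}}\left(\prod_{\substack{1 \leqslant i \leqslant n\\ p_i \leqslant 1 }} p_i\, f_{i-1}(t_n)^{\frac{p_i-1}{p_i}}\right)\left(\prod_{\substack{1\leqslant i \leqslant n\\ p_i > 1}} p_i\, f_{i-1}(t_{n+1})^{\frac{p_i-1}{p_i}}\right).$$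
   Context: The number $t_n$ is the $n$-th approximant of the continued power form $(a_1+(a_2+(a_3+\cdots)^{p_3})^{p_2})^{p_1}$; it is computed from the inside out: start with $a_n^{p_n}$ and successively, for $i=n-1,\ldots,1$, add $a_i$ and raise to the power $p_i$. The functions $f_k$ are considered where the real powers involved have positive base (which is the case for $f_{i-1}$, $1\leqslant i\leqslant n$, at the points $t_n$ and $t_{n+1}$). Empty products equal $1$. *)

(* Defs.v *)
From mathcomp Require Import all_boot all_order all_algebra.
From mathcomp Require Import reals exp.

Set Implicit Arguments.
Unset Strict Implicit.
Unset Printing Implicit Defensive.

Import Order.TTheory GRing.Theory Num.Theory.
Local Open Scope ring_scope.

(* Sequences (a_n), (p_n) with n >= 1 are functions on nat whose value at 0
   is never used. *)

(* t_n = (a_1 + (a_2 + ... + (a_{n-1} + a_n^{p_n})^{p_{n-1}} ...)^{p_2})^{p_1}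
   for n >= 1; the value at n = 0 is junk. *)
Definition cpower_approx (R : realType) (a p : nat -> R) (n : nat) : R :=
  foldr (fun i y => (a i + y) `^ p i) (a n `^ p n) (iota 1 n.-1).

(* f_k.  [powR] is total; it is the usual real power only where the base is
   positive, which holds for f_0, ..., f_{n-1} at t_n and t_{n+1}. *)
Fixpoint cpower_unwind (R : realType) (a p : nat -> R) (k : nat) (y : R) : R :=
  if k is k'.+1 then cpower_unwind a p k' y `^ (1 / p k) - a k else y.

(* Main.v *)
(** Both [t_n] and [t_(n+1)] are obtained from the same [n] outer steps
    [y |-> (a_i + y)^(p_i)], applied to [0] and to [a_(n+1)^(p_(n+1))]
    respectively, and [f_(i-1)] recovers the value inside the first [i - 1]
    steps. Each step is compared with its tangent: the power [x^(p_i)] is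
    concave when [p_i <= 1] and convex when [p_i > 1], so the increment is
    bounded by the slope at the [t_n]-value in the first case and at the
    [t_(n+1)]-value in the second; the slopes multiply along the steps. *)
Require Import Defs.
From mathcomp Require Import all_boot all_order all_algebra.
From mathcomp Require Import ring lra.
From mathcomp Require Import reals exp.

Set Implicit Arguments.
Unset Strict Implicit.
Unset Printing Implicit Defensive.

Import Order.TTheory GRing.Theory Num.Theory.
Local Open Scope ring_scope.

(** Young's inequality for the conjugate exponents [p^-1] and [(1 - p)^-1], applied to x^p and 1.
    The case [p = 1] has no finite second exponent and is split off. *)
Lemma powR_bernoulli_le1 (R : realType) (p x : R) :
  0 < p -> p <= 1 -> 0 <= x -> x `^ p <= 1 + p * (x - 1).
Proof.
move=> p0 p1 x0; move: p1; rewrite le_eqVlt => /predU1P[->|p1].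
  by rewrite powRr1 // mul1r addrC subrK.
have q0 : 0 < (1 - p)^-1 by rewrite invr_gt0 subr_gt0.
have pV0 : 0 < p^-1 by rewrite invr_gt0.
have := conjugate_powR (powR_ge0 x p) ler01 pV0 q0.
rewrite !invrK -powRrM mulfV ?gt_eqF // powRr1 // powR1 mulr1 mul1r.
by move=> /(_ (subrKC _ _)) h; apply: le_trans h _; lra.
Qed.

(** The concave case for the exponent [p^-1], taken at x^p and solved for x^p. *)
Lemma powR_bernoulli_ge1 (R : realType) (p x : R) :
  1 <= p -> 0 <= x -> 1 + p * (x - 1) <= x `^ p.
Proof.
move=> p1 x0; have p0 : 0 < p by apply: lt_le_trans p1.
have pV0 : 0 < p^-1 by rewrite invr_gt0.
have pV1 : p^-1 <= 1 by rewrite invf_le1.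
have := powR_bernoulli_le1 pV0 pV1 (powR_ge0 x p).
rewrite -powRrM mulfV ?gt_eqF // powRr1 // -lerBlDl mulrC ler_pdivlMr //.
by lra.
Qed.

(** Scaling by x^p turns Bernoulli's bound at the ratio [y / x] into the tangent line at [x]. *)
Lemma powR_tangentE (R : realType) (p x y : R) :
  0 < x ->
  x `^ p * (1 + p * (y / x - 1)) = x `^ p + p * x `^ (p - 1) * (y - x).
Proof.
move=> x0; rewrite powRB ?(gt_eqF x0) ?implybT // (powRr1 (ltW x0)).
by field; rewrite gt_eqF.
Qed.

Lemma powR_divK (R : realType) (p x y : R) :
  0 < x -> 0 <= y -> x `^ p * (y / x) `^ p = y `^ p.
Proof.
move=> x0 y0; rewrite -powRM ?divr_ge0 // ?ltW //.
by rewrite mulrC divfK // gt_eqF.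
Qed.

Lemma powR_le_tangent (R : realType) (p x y : R) :
  0 < p -> p <= 1 -> 0 < x -> 0 <= y ->
  y `^ p <= x `^ p + p * x `^ (p - 1) * (y - x).
Proof.
move=> p0 p1 x0 y0; rewrite -(powR_divK p x0 y0) -powR_tangentE //.
by rewrite ler_wpM2l ?powR_ge0 // powR_bernoulli_le1 // divr_ge0 // ltW.
Qed.

Lemma powR_ge_tangent (R : realType) (p x y : R) :
  1 <= p -> 0 < x -> 0 <= y ->
  x `^ p + p * x `^ (p - 1) * (y - x) <= y `^ p.
Proof.
move=> p1 x0 y0; rewrite -(powR_divK p x0 y0) -powR_tangentE //.
by rewrite ler_wpM2l ?powR_ge0 // powR_bernoulli_ge1 // divr_ge0 // ltW.
Qed.

Section Steps.
Variables (R : realType) (a p : nat -> R).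
Hypothesis ha : forall i : nat, (1 <= i)%N -> 0 < a i.
Hypothesis hp : forall i : nat, (1 <= i)%N -> 0 < p i.

(* [u i] is the value inside the first [i - 1] powers of a continued power form,
   so [u 1] is its total value and [u n.+1] its innermost term. *)
Definition cpower_steps (n : nat) (u : nat -> R) : Prop :=
  forall i, (1 <= i <= n)%N -> 0 <= u i.+1 /\ u i = (a i + u i.+1) `^ p i.

Lemma cpower_stepsW n u : cpower_steps n.+1 u -> cpower_steps n u.
Proof. by move=> h i /andP[i1 ilen]; apply: h; rewrite i1 leqW. Qed.

Lemma cpower_unwind_steps n u k : cpower_steps n u -> (k <= n)%N ->
  cpower_unwind a p k (u 1%N) = u k.+1.
Proof.
move=> hu; elim: k => [//|k IH] kn /=; rewrite IH ?(ltnW kn) //.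
have [u0 ->] := hu k.+1 kn.
have [a0 p0] := (ha (ltn0Sn k), hp (ltn0Sn k)).
rewrite -powRrM mul1r mulfV ?gt_eqF // powRr1; last by rewrite addr_ge0 // ltW.
by rewrite addrC addKr.
Qed.

(** Since [u i] is itself a power of exponent [p i], the exponent [(p i - 1) / p i] yields the
    derivative of the step, up to the factor [p i]. *)
Lemma cpower_step_slope i u : (1 <= i)%N ->
  u i = (a i + u i.+1) `^ p i ->
  u i `^ ((p i - 1) / p i) = (a i + u i.+1) `^ (p i - 1).
Proof.
by move=> i1 ->; rewrite -powRrM mulrC divfK // gt_eqF // hp.
Qed.

(** Merges the two products of the bound into one, so that an induction can peel off one factor at a
    time. *)
Definition cpower_slope (u v : nat -> R) (i : nat) : R :=
  p i * (if p i <= 1 then u i else v i) `^ ((p i - 1) / p i).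

Lemma cpower_slope_ge0 u v i : (1 <= i)%N -> 0 <= cpower_slope u v i.
Proof. by move=> i1; rewrite mulr_ge0 ?powR_ge0 // ltW // hp. Qed.

(** Induction strips the innermost step, whose tangent bound is multiplied by the nonnegative slopes
    of the outer ones. *)
Lemma cpower_steps_sub_le n u v : cpower_steps n u -> cpower_steps n v ->
  v 1%N - u 1%N <=
    (v n.+1 - u n.+1) * \prod_(1 <= i < n.+1) cpower_slope u v i.
Proof.
elim: n => [|n IH] hu hv; first by rewrite big_nil mulr1.
apply: le_trans (IH (cpower_stepsW hu) (cpower_stepsW hv)) _.
rewrite (big_nat_recr n.+1) //= mulrA mulrAC ler_wpM2r //.
  by rewrite big_seq prodr_ge0 // => i; rewrite mem_index_iota => /andP[i1 _];
     rewrite cpower_slope_ge0.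
have [u0 uE] := hu n.+1 (leqnn n.+1); have [v0 vE] := hv n.+1 (leqnn n.+1).
have [a0 p0] := (ha (ltn0Sn n), hp (ltn0Sn n)).
have au0 : 0 < a n.+1 + u n.+2 by rewrite ltr_wpDr.
have av0 : 0 < a n.+1 + v n.+2 by rewrite ltr_wpDr.
rewrite /cpower_slope; case: ifP => [p1|/negbT].
  rewrite cpower_step_slope // uE vE.
  have := powR_le_tangent p0 p1 au0 (ltW av0); lra.
rewrite -ltNge => /ltW p1; rewrite cpower_step_slope // uE vE.
(* The tangent at the [v]-value bounds [u n.+1] from below, hence the difference from above. *)
have := powR_ge_tangent p1 av0 (ltW au0); lra.
Qed.

Definition cpower_tail (n : nat) (c : R) (i : nat) : R :=
  foldr (fun j y => (a j + y) `^ p j) c (iota i (n.+1 - i)).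

Lemma cpower_tail_ge0 n c i : 0 <= c -> 0 <= cpower_tail n c i.
Proof.
by rewrite /cpower_tail; case: (iota _ _) => //= j s _; exact: powR_ge0.
Qed.

Lemma cpower_tail_steps n c : 0 <= c -> cpower_steps n (cpower_tail n c).
Proof.
move=> c0 i /andP[i1 ilen]; split; first exact: cpower_tail_ge0.
by rewrite /cpower_tail subSn //= subSS.
Qed.

Lemma cpower_tail_last n c : cpower_tail n c n.+1 = c.
Proof. by rewrite /cpower_tail subnn. Qed.

Lemma cpower_approxS n :
  cpower_approx a p n.+1 = cpower_tail n (a n.+1 `^ p n.+1) 1.
Proof. by rewrite /cpower_approx /cpower_tail subSS subn0. Qed.

(** The innermost term a_n^(p_n) equals (a_n + 0)^(p_n), so it counts as one more step, applied to
    0. *)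
Lemma cpower_approxE n : (1 <= n)%N -> cpower_approx a p n = cpower_tail n 0 1.
Proof.
case: n => // n _; rewrite cpower_approxS /cpower_tail !subSS !subn0.
by rewrite -[in RHS](addn1 n) iotaD foldr_cat /= add1n addr0.
Qed.

End Steps.

Theorem theorem3p3 (R : realType) (a p : nat -> R)
    (ha : forall i : nat, (1 <= i)%N -> 0 < a i)
    (hp : forall i : nat, (1 <= i)%N -> 0 < p i)
    (n : nat) (hn : (1 <= n)%N) :
  cpower_approx a p n.+1 - cpower_approx a p n <=
    a n.+1 `^ p n.+1
    * (\prod_(1 <= i < n.+1 | p i <= 1)
         (p i * cpower_unwind a p i.-1 (cpower_approx a p n)
                  `^ ((p i - 1) / p i)))
    * (\prod_(1 <= i < n.+1 | 1 < p i)
         (p i * cpower_unwind a p i.-1 (cpower_approx a p n.+1)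
                  `^ ((p i - 1) / p i))).
Proof.
have hu := @cpower_tail_steps R a p n 0 (lexx 0).
have hv := @cpower_tail_steps R a p n _ (powR_ge0 (a n.+1) (p n.+1)).
(* Both filtered products are padded with 1 to the full range, then fused index by index. *)
rewrite -mulrA [X in _ * (X * _)]big_mkcond [X in _ * (_ * X)]big_mkcond.
rewrite -big_split /= (cpower_approxE a p hn) cpower_approxS.
apply: le_trans (cpower_steps_sub_le ha hp hu hv) _.
rewrite !cpower_tail_last subr0 le_eqVlt; apply/orP; left; apply/eqP.
congr (_ * _); apply: eq_big_nat => -[//|i] /andP[_ /ltnW ilen].
rewrite /cpower_slope /=.
rewrite (@cpower_unwind_steps _ _ _ ha hp _ _ i hu ilen).
rewrite (@cpower_unwind_steps _ _ _ ha hp _ _ i hv ilen).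
(* Exactly one of the two filters holds at each index, so the other factor is 1. *)
by rewrite ltNge; case: (p i.+1 <= 1); rewrite ?mulr1 ?mul1r.
Qed.
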